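(* Let $\mathcal{H}$ be the underlying Heyting algebra of a totally ordered filtration, with elements $\mathbb{X}_i \in \mathcal{H}$ for $i$ in an index set $I$. Then for all $i,j\in I$, $$\mathbb{X}_i\Rightarrow \mathbb{X}_j = \begin{cases} \mathbb{X}_j, & \text{if } \mathbb{X}_j < \mathbb{X}_i,\\ \top, & \text{if } \mathbb{X}_i\leq \mathbb{X}_j. \end{cases}$$
   Context: A Heyting algebra is a distributive lattice with least element $\perp$ in which, for all elements $a,b$, there is a greatest element $x$ satisfying $a\wedge x\leq b$; this element is denoted $a\Rightarrow b$. The greatest element of the algebra is denoted $\top$. The underlying Heyting algebra of a totally ordered filtration is the complete totally ordered set $\mathcal{H}=\{\mathbb{X}_i\}_{i\in I}$ whose elements are the spaces of the filtration (or their homology vector spaces over a field, with isomorphic objects identified), where $\mathbb{X}_i\leq\mathbb{X}_j$ means that there is a map $\mathbb{X}_i\to\mathbb{X}_j$ in the filtration. Meet and join are given by the minimum and maximum, respectively, for this order. It is bounded by a greatest element $\top$ (the final space of the filtration) and a least element $\perp$ (the initial space). *)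

(* Defs.v *)
From HB Require Import structures.
From mathcomp Require Import all_boot all_order all_algebra.
From mathcomp Require Import all_classical.

Set Implicit Arguments.
Unset Strict Implicit.
Unset Printing Implicit Defensive.

Import Order.TTheory.

Local Open Scope classical_set_scope.
Local Open Scope order_scope.

(* [Order.TBDistrLattice] also asks for a greatest element; every Heyting
   algebra has one, namely [himp a a]. *)
HB.mixin Record hasHeytingImp d T of Order.TBDistrLattice d T := {
  himp : T -> T -> T;
  himp_meet_le : forall a b : T, Order.meet a (himp a b) <= b;
  himp_greatest : forall a b x : T, Order.meet a x <= b -> x <= himp a b
}.

#[short(type="heytingType")]
HB.structure Definition Heyting d :=
  {T of hasHeytingImp d T & Order.TBDistrLattice d T}.

Notation "a ⇒ b" := (himp a b) (at level 55, right associativity) : order_scope.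

Record category := Category {
  ob :> Type;
  hom : ob -> ob -> Type;
  idm : forall A, hom A A;
  compm : forall A B C, hom B C -> hom A B -> hom A C;
  compm1 : forall A B (f : hom A B), compm f (idm A) = f;
  comp1m : forall A B (f : hom A B), compm (idm B) f = f;
  compmA : forall A B C D (h : hom C D) (g : hom B C) (f : hom A B),
    compm h (compm g f) = compm (compm h g) f
}.

Definition isomorphic (C : category) (A B : C) : Prop :=
  exists (f : hom A B) (g : hom B A),
    compm g f = idm A /\ compm f g = idm B.

(* Two examples of ambient categories. In the first one, used for nested
   families of subspaces, isomorphic objects are equal subspaces, and not just
   homeomorphic ones. *)
Definition subspaces (T : Type) : category.
Proof.
refine (@Category (set T) (fun A B => A `<=` B)
  (@subset_refl T) (fun A B C BC AB => subset_trans AB BC) _ _ _);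
by move=> *; exact: Prop_irrelevance.
Defined.

Lemma isomorphic_subspaces (T : Type) (A B : subspaces T) :
  isomorphic A B <-> A = B.
Proof.
split; first by move=> [f [g _]]; apply/seteqP.
by move=> ->; exists (idm B), (idm B); rewrite compm1.
Qed.

Section vector_spaces.
Variable K : fieldType.

Let linear_id (U : lmodType K) : linear (@id U).
Proof. by []. Qed.

Let linear_comp (U V W : lmodType K) (g : V -> W) (f : U -> V) :
  linear g -> linear f -> linear (g \o f).
Proof. by move=> gl fl a x y; rewrite /= fl gl. Qed.

Definition vector_spaces : category.
Proof.
refine (@Category (lmodType K) (fun U V => {f : U -> V | linear f})
  (fun U => exist _ _ (@linear_id U))
  (fun U V W g f => exist _ _ (linear_comp (svalP g) (svalP f))) _ _ _).
- by move=> U V [f fl]; exact: eq_exist.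
- by move=> U V [f fl]; exact: eq_exist.
- by move=> U V W Z [h hl] [g gl] [f fl]; exact: eq_exist.
Defined.

End vector_spaces.

Record filtration d (I : orderType d) (C : category) := Filtration {
  space :> I -> C;
  fmap : forall i j, i <= j -> hom (space i) (space j);
  fmap_id : forall i (ii : i <= i), fmap ii = idm (space i);
  fmap_comp : forall i j k (ij : i <= j) (jk : j <= k) (ik : i <= k),
    fmap ik = compm (fmap jk) (fmap ij)
}.

Section elements.
Context {d : Order.disp_t} {I : orderType d} {C : category}.
Variable F : filtration I C.

(* The space [F i] up to isomorphism, encoded by the set of all indices at
   which an isomorphic space occurs. *)
Definition iso_class (i : I) : set I := [set k | isomorphic (F k) (F i)].

Definition element : Type := set_type (range iso_class).

Definition to_element (i : I) : element := SigSub (mem_set (imageT iso_class i)).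

(* The maps of the filtration are the [fmap ij] for [ij : i <= j]. *)
Definition element_le (a b : element) : Prop :=
  exists i j : I, [/\ a = to_element i, b = to_element j & i <= j].

End elements.

(* Identifying isomorphic objects may break antisymmetry (e.g. for homology
   vector spaces 0, K, 0 at three successive indices), hence the field
   [tfilt_anti]. *)
Record total_filtration d (I : orderType d) (C : category) := TotalFiltration {
  tfilt :> filtration I C;
  tfilt_anti : forall a b : element tfilt,
    element_le a b -> element_le b a -> a = b;
  tfilt_sup : forall S : set (element tfilt), exists s,
    (forall a, S a -> element_le a s) /\
    (forall t, (forall a, S a -> element_le a t) -> element_le s t);
  tfilt_inf : forall S : set (element tfilt), exists s,
    (forall a, S a -> element_le s a) /\
    (forall t, (forall a, S a -> element_le t a) -> element_le t s)
}.

Definition underlying d (I : orderType d) C (F : total_filtration I C) : Type :=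
  element F.

Definition to_underlying d (I : orderType d) C (F : total_filtration I C)
  (i : I) : underlying F := to_element F i.

Fact underlying_display : Order.disp_t. Proof. exact: Order.Disp tt tt. Qed.

Section underlying_heyting.
Context {d : Order.disp_t} {I : orderType d} {C : category}.
Variable F : total_filtration I C.
Local Notation H := (underlying F).

HB.instance Definition _ := Choice.copy H (element F).

Let le (a b : H) : bool := `[< element_le a b >].

Lemma to_underlying_surj (a : H) : exists i, a = to_underlying F i.
Proof.
case: a => a aP; have := set_mem aP => -[i _ ai].
by exists i; apply: val_inj.
Qed.

Lemma to_underlying_le (i j : I) :
  i <= j -> element_le (to_underlying F i) (to_underlying F j).
Proof. by move=> ij; exists i, j. Qed.

Let le_refl : reflexive le.
Proof.
by move=> a; have [i ->] := to_underlying_surj a; apply/asboolP; exists i, i.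
Qed.

Let le_anti : antisymmetric le.
Proof. by move=> a b /andP[/asboolP ab /asboolP ba]; exact: tfilt_anti. Qed.

Let le_total : total le.
Proof.
move=> a b; have [i ->] := to_underlying_surj a.
have [j ->] := to_underlying_surj b.
by apply/orP; have [ij|/ltW ji] := leP i j; [left|right];
  apply/asboolP; exact: to_underlying_le.
Qed.

Let le_trans : transitive le.
Proof.
move=> b a c /asboolP ab /asboolP bc; apply/asboolP.
have [i [j [ai bj ij]]] := ab; have [j' [k [bj' ck jk]]] := bc.
have [ik|/ltW ki] := leP i k; first by exists i, k.
have ba : element_le b a by exists j', i; split=> //; exact: Order.POrderTheory.le_trans ki.
by rewrite (tfilt_anti ab ba).
Qed.

HB.instance Definition _ :=
  Order.Le_isPOrder.Build underlying_display H le_refl le_anti le_trans.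
HB.instance Definition _ :=
  Order.POrder_isTotal.Build underlying_display H le_total.

Lemma underlying_leE (a b : H) : (a <= b) = `[< element_le a b >].
Proof. by []. Qed.

Definition underlying_sup (S : set H) : H := sval (cid (tfilt_sup S)).

Lemma underlying_sup_ub (S : set H) (a : H) : S a -> a <= underlying_sup S.
Proof.
rewrite underlying_leE /underlying_sup; case: cid => s /= [sub _] Sa.
by apply/asboolP; exact: sub.
Qed.

Lemma underlying_sup_le (S : set H) (t : H) :
  (forall a, S a -> a <= t) -> underlying_sup S <= t.
Proof.
rewrite underlying_leE /underlying_sup; case: cid => s /= [_ slub] St.
by apply/asboolP/slub => a /St /asboolP.
Qed.

Let bot_le (a : H) : underlying_sup set0 <= a.
Proof. exact: underlying_sup_le. Qed.

Let le_top (a : H) : a <= underlying_sup setT.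
Proof. exact: underlying_sup_ub. Qed.

HB.instance Definition _ :=
  Order.hasBottom.Build underlying_display H bot_le.
HB.instance Definition _ :=
  Order.hasTop.Build underlying_display H le_top.

Let imp (a b : H) : H := underlying_sup [set x | Order.meet a x <= b].

Let imp_meet_le (a b : H) : Order.meet a (imp a b) <= b.
Proof.
rewrite leIx; have [//|ba] := leP a b; apply: underlying_sup_le => x /=.
by rewrite leIx leNgt ba.
Qed.

Let imp_greatest (a b x : H) : Order.meet a x <= b -> x <= imp a b.
Proof. by move=> axb; exact: underlying_sup_ub. Qed.

HB.instance Definition _ :=
  hasHeytingImp.Build underlying_display H imp_meet_le imp_greatest.

End underlying_heyting.

(* Main.v *)
Require Import Defs.
From mathcomp Require Import all_boot all_order.

(** By the universal property of the implication, [a ⇒ b] is the greatest [x]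
with [a ∧ x <= b].  If [a <= b], every [x] qualifies, hence the greatest one is
the top element ([himp_top]).  In a chain, [a ∧ x] is the minimum of [a] and
[x], so when [b < a] the condition [a ∧ x <= b] can only be met through [x]
itself: it says [x <= b], and the greatest such [x] is [b].  Since the identified
spaces of a totally ordered filtration form a chain, these two cases are
exhaustive. *)

Import Order.TTheory.

Local Open Scope order_scope.

Lemma himp_top (d : Order.disp_t) (T : heytingType d) (a b : T) :
  a <= b -> a ⇒ b = \top.
Proof.
move=> ab; apply/eqP; rewrite -le1x; apply: himp_greatest.
exact: le_trans (leIl _ _) ab.
Qed.

Lemma le_himp (d : Order.disp_t) (T : heytingType d) (a b : T) : b <= a ⇒ b.
Proof. by apply: himp_greatest; exact: leIr. Qed.

Lemma himp_underlying_lt (d : Order.disp_t) (I : orderType d) (C : category)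
    (F : total_filtration I C) (a b : underlying F) :
  b < a -> a ⇒ b = b.
Proof.
move=> ba; apply: le_anti; rewrite le_himp andbT.
(* In a chain, a meet lies below [b] only if one of its two terms does; here
   [a] does not. *)
by have := himp_meet_le a b; rewrite leIx leNgt ba.
Qed.

Theorem theorem4p1 (d : Order.disp_t) (I : orderType d) (C : category)
    (F : total_filtration I C) (i j : I) :
  to_underlying F i ⇒ to_underlying F j =
    if to_underlying F j < to_underlying F i then to_underlying F j else \top.
Proof.
have [ij|ji] := leP (to_underlying F i) (to_underlying F j).
  exact: himp_top.
exact: himp_underlying_lt.
Qed.
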